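(* Let $\mathcal{A},\mathcal{B}\in\mathbb{T}_{p,n}$ with $p\geq 3$ being an even number. Suppose that the equation $(\mathcal{A}+t\mathcal{I})x^{p-1}+\mathcal{B}|x|^{p-1}=\mathbf{0}$ has no solution $(x,t)\in(\mathbb{R}^n\setminus\{\mathbf{0}\})\times\mathbb{R}_+$. Then for any $b\in\mathbb{R}^n$ the solution set $${\rm SOL}(\mathcal{A},\mathcal{B},b)=\{x\in\mathbb{R}^n : \mathcal{A}x^{p-1}+\mathcal{B}|x|^{p-1}=b\}$$ is a nonempty compact set.
   Context: $\mathbb{T}_{m,n}$ is the set of real $m$-th order $n$-dimensional square tensors $\mathcal{A}=(a_{i_1i_2\ldots i_m})$, with $a_{i_1\ldots i_m}\in\mathbb{R}$, $1\le i_1,\ldots,i_m\le n$ (no symmetry assumed). For $\mathcal{A}\in\mathbb{T}_{m,n}$ and $x\in\mathbb{R}^n$, $\mathcal{A}x^{m-1}\in\mathbb{R}^n$ is the vector with components $(\mathcal{A}x^{m-1})_i=\sum_{i_2,\ldots,i_m=1}^n a_{ii_2\ldots i_m}x_{i_2}\cdots x_{i_m}$. The vector $|x|$ is the componentwise absolute value of $x$, and $\mathcal{B}|x|^{p-1}$ denotes $\mathcal{B}y^{p-1}$ with $y=|x|$. The unit tensor $\mathcal{I}\in\mathbb{T}_{p,n}$ has entries $1$ if all $p$ indices coincide and $0$ otherwise, so $(\mathcal{I}x^{p-1})_i=x_i^{p-1}$. $\mathbb{R}_+=[0,\infty)$. *)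

(* Defs.v *)
From mathcomp Require Import all_boot all_order all_algebra.
From mathcomp Require Import all_classical all_reals all_analysis.
Import Order.TTheory GRing.Theory Num.Theory.
Import numFieldNormedType.Exports.

Set Implicit Arguments.
Unset Strict Implicit.
Unset Printing Implicit Defensive.

Local Open Scope ring_scope.
Local Open Scope classical_set_scope.

(* The codomain is [R^o] so that tensors inherit the R-module structure of
   finite functions, as needed for [A + t *: I]. *)
Definition tensor (R : realType) (m n : nat) :=
  {ffun m.-tuple 'I_n -> R^o}.

Definition unit_tensor (R : realType) (m n : nat) : tensor R m n :=
  [ffun s : m.-tuple 'I_n => (constant s)%:R].

(* The sum runs over the full multi-indices s = (i_1, ..., i_m) with i_1 = i,
   which avoids casting between [m] and [m.-1.+1]; meaningful for m >= 1. *)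
Definition tensor_apply (R : realType) (m n : nat) (A : tensor R m n)
    (x : 'rV[R]_n) : 'rV[R]_n :=
  \row_i \sum_(s : m.-tuple 'I_n | ohead s == Some i)
     (A s : R) * \prod_(j <- behead s) x 0 j.

(* Componentwise; [`|x|] would denote the sup norm of the matrix. *)
Definition abs_vec (R : realType) (n : nat) (x : 'rV[R]_n) : 'rV[R]_n :=
  map_mx Num.norm x.

Definition SOL (R : realType) (p n : nat) (A B : tensor R p n) (b : 'rV[R]_n) :
    set 'rV[R]_n :=
  [set x | tensor_apply A x + tensor_apply B (abs_vec x) = b].

(* Main.v *)
Require Import Defs.
From HB Require Import structures.
From mathcomp Require Import all_boot all_order all_algebra.
From mathcomp Require Import all_classical all_reals all_analysis.
From mathcomp Require Import fintype finset lra zify.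
Import Order.TTheory GRing.Theory Num.Theory.
Import numFieldNormedType.Exports.

(** Write q = p - 1, F(x) = A x^q + B|x|^q, and x^[q] for the vector of the
    powers x_i^q, which is the unit tensor applied to x.

    The maps F and x^[q] are continuous and positively homogeneous of degree q,
    and the hypothesis says that F(x) + t x^[q] vanishes only at x = 0 when
    t >= 0. Compactness of the unit sphere upgrades this to a bound
    d |x|^q <= |F(x) + t x^[q]| with one constant d > 0 for all t >= 0
    ([homogeneous_coercive]); for large t the term t x^[q] dominates, so that
    only a compact range of t matters. The case t = 0 bounds SOL, which is
    closed by continuity, hence compact.

    For existence, q is odd, so x |-> x^[q] has a continuous inverse, the
    coordinatewise q-th root ([odd_root]). Put G(y) = F(y^[1/q]) - b. If
    G(y) = - s y with s > 0, then x = y^[1/q] satisfies F(x) + s x^[q] = b, so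
    the bound above controls |y| independently of s. A continuous map of R^n
    that points towards the origin only inside a fixed ball has a zero
    ([leray_schauder]): otherwise - r G(y) / |G(y)| would have a fixed point on
    the sphere of radius r, by Brouwer's theorem on a simplex that contains the
    ball of radius r.

    Brouwer's theorem ([brouwer]) is derived from a combinatorial lemma of Scarf
    ([scarf]), an analogue of Sperner's lemma in which triangulations are
    replaced by the orderings of a finite point set according to each
    coordinate. It is proved by a parity count over the pairs formed by a
    primitive set and one of its facets. *)

Set Implicit Arguments.
Unset Strict Implicit.
Unset Printing Implicit Defensive.

(** * Scarf's lemma on primitive sets *)

(** No element lies strictly above the minimum of P for every ranking. Over the
    points of a simplex ranked by coordinates, this says that the smallest
    homothetic simplex containing P has no point in its interior. *)
Definition primitive (X I : finType) (r : I -> X -> nat) (P : {set X}) : bool :=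
  [forall y, exists i, forall (x | x \in P), r i y <= r i x].

Lemma primitiveP (X I : finType) (r : I -> X -> nat) (P : {set X}) :
  reflect (forall y, exists i, forall x, x \in P -> r i y <= r i x)
          (primitive r P).
Proof.
apply: (iffP forallP) => h y.
  by have /existsP[i /forall_inP hi] := h y; exists i.
by have [i hi] := h y; apply/existsP; exists i; apply/forall_inP.
Qed.

Lemma primitiveS (X I : finType) (r : I -> X -> nat) (P Q : {set X}) :
  Q \subset P -> primitive r P -> primitive r Q.
Proof.
move=> /subsetP QP /primitiveP h; apply/primitiveP => y.
by have [i hi] := h y; exists i => x /QP; apply: hi.
Qed.

Lemma card_argmax (X : finType) (f : X -> nat) (Z : {set X}) :
  injective f ->
  #|[set x in Z | [forall (y | y \in Z), f y <= f x]]| = (Z != set0) :> nat.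
Proof.
move=> f_inj; case: (set_0Vmem Z) => [->|[z0 z0Z]].
  by rewrite eqxx (_ : [set _ in _ | _] = set0) ?cards0//; apply/setP => x; rewrite !inE.
have /eqP -> : (Z != set0) == true by rewrite eqb_id; apply/set0Pn; exists z0.
case: (arg_maxnP f z0Z) => z zZ z_max.
rewrite (_ : [set _ in _ | _] = [set z]) ?cards1//; apply/setP => x; rewrite !inE.
apply/andP/eqP => [[xZ /forall_inP x_max]|->]; last first.
  by split=> //; apply/forall_inP => y yZ; exact: z_max.
by apply/f_inj/anti_leq/andP; split; [exact: z_max | exact: x_max].
Qed.

(** When m selects the minima of a set D, these are the elements that exceed them
    in all rankings but the k-th: the elements that could extend D by becoming
    its new k-th minimum. *)
Definition beyond (X I : finType) (r : I -> X -> nat) (m : I -> X) (k : I) :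
  {set X} := [set x | [forall (l | l != k), r l (m l) < r l x]].

(** Applying primitivity to an element of D itself yields a ranking that it
    minimizes on D. *)
Lemma primitive_min (X I : finType) (r : I -> X -> nat) (D : {set X})
    (m : I -> X) (r_inj : forall i, injective (r i))
    (mD : forall i, m i \in D)
    (m_min : forall i x, x \in D -> r i (m i) <= r i x) :
  primitive r D -> forall x, x \in D -> exists l, x = m l.
Proof.
move=> /primitiveP D_prim x xD; have [l hl] := D_prim x.
by exists l; apply: (r_inj l); apply/eqP; rewrite eqn_leq hl ?m_min.
Qed.

(** A door has one element less than there are rankings, so two rankings i and j
    share their minimum. A completion by x makes x the minimum for one of them,
    and primitivity forces x to be the topmost candidate on that side; hence each
    nonempty side contributes exactly one completion. *)
Lemma completions (X I : finType) (r : I -> X -> nat) (D : {set X})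
    (m : I -> X) (i j : I) (r_inj : forall i, injective (r i))
    (mD : forall i, m i \in D)
    (m_min : forall i x, x \in D -> r i (m i) <= r i x) :
  i != j -> m i = m j -> primitive r D -> #|D|.+1 = #|I| ->
  #|[set x | (x \notin D) && primitive r (x |: D)]|
    = (beyond r m i != set0) + (beyond r m j != set0).
Proof.
move=> ij mij D_prim cardD.
have D_min := primitive_min r_inj mD m_min D_prim.
pose top k := [set x in beyond r m k
  | [forall (y | y \in beyond r m k), r k y <= r k x]].
have disj : top i :&: top j = set0.
  apply/setP => x; rewrite !inE; apply/negP => /andP[/andP[/forall_inP xi _]].
  move=> /andP[/forall_inP xj _].
  have /primitiveP/(_ x)[l hl] := D_prim.
  have := hl _ (mD l); rewrite leqNgt => /negP; apply.
  by have [li|/xi//] := eqVneq l i; apply: xj; rewrite li.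
rewrite -(card_argmax _ (r_inj i)) -(card_argmax _ (r_inj j)) -/(top i) -/(top j).
rewrite -[RHS]subn0 -(cards0 X) -disj -cardsU; apply: eq_card => x; rewrite in_setU inE.
apply/andP/orP => [[xD /primitiveP xD_prim]|].
  (* m' picks the minima of x |: D. Since x |: D is primitive, m' maps I onto
     it, and the cardinalities agree, so m' is injective: x is the minimum for
     a single index k, and k is i or j because m' cannot merge them. *)
  pose m' l := if r l x < r l (m l) then x else m l.
  have m'_surj : x |: D \subset m' @: setT.
    apply/subsetP => z zxD; have [l hl] := xD_prim z.
    apply/imsetP; exists l => //; rewrite /m'; case: ifP => [lt|/negbT].
      case/setU1P: zxD => [//|zD]; move: lt; rewrite ltnNge => /negP[].
      exact: leq_trans (m_min _ _ zD) (hl x (setU11 _ _)).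
    rewrite -leqNgt => mx; apply: (r_inj l); apply/eqP; rewrite eqn_leq.
    by rewrite hl ?setU1r//=; case/setU1P: zxD => [->//|]; apply: m_min.
  have m'_inj : injective m'.
    have : #|m' @: setT| == #|[set: I]|.
      rewrite eqn_leq leq_imset_card cardsT -cardD.
      by move: (subset_leq_card m'_surj); rewrite cardsU1 xD.
    by move=> /imset_injP inj a b; apply: inj; rewrite inE.
  have [k hk] := xD_prim x.
  have xk : m' k = x.
    rewrite /m'; case: ifPn => //; rewrite -leqNgt => h.
    apply/(r_inj k)/eqP; rewrite eqn_leq h (hk (m k)) ?setU1r//.
  have x_bey : x \in beyond r m k.
    rewrite inE; apply/forall_inP => l lk.
    have : m' l != x by rewrite -xk; apply: contraNneq lk => /m'_inj ->.
    rewrite /m'; case: ifPn; rewrite ?eqxx// -leqNgt leq_eqVlt.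
    by case/predU1P => // /(r_inj l) mlx; rewrite mlx eqxx.
  have x_top : x \in top k.
    rewrite inE x_bey; apply/forall_inP => y /[!inE] /forall_inP yk.
    have [l hl] := xD_prim y; have [<-|/yk] := eqVneq l k.
      by apply: hl; rewrite setU11.
    by rewrite ltnNge hl ?setU1r.
  have [<-|ki] := eqVneq k i; first by left.
  have [<-|kj] := eqVneq k j; first by right.
  have m'E l : l != k -> m' l = m l.
    move=> lk; rewrite /m' ltnNge ltnW //.
    by move: x_bey; rewrite inE => /forall_inP; apply.
  case/eqP: ij; apply: m'_inj; rewrite !m'E // eq_sym//.
(* Conversely, a point that is extremal beyond the door on the side of k, where
   k is redundant since k' has the same minimum, completes the door. *)
have back k k' : k != k' -> m k = m k' -> x \in top k ->
    x \notin D /\ primitive r (x |: D).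
  move=> kk' mkk'; rewrite !inE => /andP[/forall_inP x_bey /forall_inP x_max].
  split.
    apply/negP => /D_min[l xl].
    have [lk|/x_bey] := eqVneq l k; last by rewrite xl ltnn.
    have : k' != k by rewrite eq_sym.
    by move=> /x_bey; rewrite xl lk mkk' ltnn.
  apply/primitiveP => y; have /primitiveP/(_ y)[l hl] := D_prim.
  have out l' : l' != k -> r l' y <= r l' (m l') ->
      exists i0, forall z, z \in x |: D -> r i0 y <= r i0 z.
    move=> l'k yl'; exists l' => z /setU1P[->|zD].
      by apply: leq_trans yl' _; apply/ltnW/x_bey.
    by apply: leq_trans yl' _; apply: m_min.
  have [lk|lk] := eqVneq l k; last by apply: (out l) => //; apply: hl.
  have [y_bey|] := boolP (y \in beyond r m k).
    by exists k => z /setU1P[->|zD]; [exact: x_max | rewrite -lk hl].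
  rewrite inE negb_forall_in => /exists_inP[l' l'k]; rewrite -leqNgt.
  exact: out.
by case; [apply: (back i j) | apply: (back j i); rewrite // eq_sym].
Qed.

(** If P has all colors but i0 after the removal of x, and P is not rainbow, then
    the color of x is repeated by exactly one other element x', and x and x' are
    the only two elements whose removal leaves all colors but i0. *)
Lemma even_rainbow_facets (X I : finType) (c : X -> I) (i0 : I)
    (P : {set X}) :
  #|P| = #|I| -> c @: P != setT ->
  ~~ odd #|[set x in P | c @: (P :\ x) == [set~ i0]]|.
Proof.
move=> cardP cP.
set Q := [set x in P | _]; case: (set_0Vmem Q) => [->|[x]]; first by rewrite cards0.
rewrite inE => /andP[xP /eqP cx].
have inj z : z \in P -> c @: (P :\ z) = [set~ i0] -> {in P :\ z &, injective c}.
  move=> zP cz; apply/imset_injP; rewrite cz cardsC1 -cardP.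
  by rewrite (cardsD1 z P) zP add1n.
have cPx : c @: P = c x |: c @: (P :\ x) by rewrite -imsetU1 setD1K.
have : c x \in c @: (P :\ x).
  rewrite cx !inE; apply: contraNneq cP => cxi0.
  by rewrite cPx cxi0 cx; apply/eqP/setP => k; rewrite !inE orbN.
case/imsetP => x' x'P cxx'.
have [x'x x'P'] : x' != x /\ x' \in P by move: x'P; rewrite !inE => /andP[].
suff -> : Q = [set x; x'] by rewrite cards2 eq_sym x'x.
apply/setP => z; rewrite !inE; apply/andP/orP => [[zP /eqP cz]|].
  apply/orP; rewrite -[_ || _]negbK negb_or; apply/negP => /andP[zx zx'].
  by case/eqP: x'x; apply: (inj _ zP cz); rewrite ?inE 1?eq_sym ?zx ?zx' ?x'P' ?xP.
case=> /eqP ->; first by rewrite cx.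
split=> //; rewrite -cx.
have -> : c @: (P :\ x') = c @: P.
  rewrite -{2}(setD1K x'P') imsetU1; apply/esym/setUidPr; rewrite sub1set.
  by apply/imsetP; exists x; rewrite // !inE eq_sym x'x.
by rewrite cPx; apply/eqP/setUidPr; rewrite sub1set; apply/imsetP; exists x'.
Qed.

(** Both sides count the pairs (D, x) in which a door D colored by all colors but
    i0 is completed by x to a primitive set; on the right they are grouped by
    the union P of D and x. *)
Lemma door_room_count (X I : finType) (r : I -> X -> nat) (c : X -> I)
    (i0 : I) :
  \sum_(D : {set X} | (#|D|.+1 == #|I|) && (c @: D == [set~ i0]))
     #|[set x | (x \notin D) && primitive r (x |: D)]| =
  \sum_(P : {set X} | (#|P| == #|I|) && primitive r P)
     #|[set x in P | c @: (P :\ x) == [set~ i0]]|.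
Proof.
under eq_bigr do rewrite -sum1dep_card.
under [RHS]eq_bigr do rewrite -sum1dep_card.
rewrite (exchange_big_dep predT)//= [RHS](exchange_big_dep predT)//=.
apply: eq_bigr => x _.
rewrite (reindex_onto (fun P : {set X} => P :\ x) (fun D => x |: D)) /=; last first.
  by move=> D /andP[_ /andP[xD _]]; rewrite setU1K.
apply: eq_bigl => P; rewrite !inE eqxx /=.
have [xP|xP] := boolP (x \in P); last first.
  rewrite andbF; apply: negbTE; apply: contra xP => /andP[_ /eqP <-].
  by rewrite setU11.
rewrite setD1K // eqxx andbT (cardsD1 x P) xP add1n.
by rewrite -!andbA; congr (_ && _); rewrite andbC.
Qed.

(** One slack element per ranking plays the role of a facet of the simplex: it is
    lowest for its own ranking and above all points for the others. With these
    elements all primitive sets of interest have as many elements as there are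
    rankings, instead of using a varying subset of the rankings. *)
Definition slack_rank (T I : finType) (r : I -> T -> nat) (i : I)
    (u : T + I) : nat :=
  match u with
  | inl x => (r i x).+1
  | inr j => if j == i then 0 else (\max_x r i x).+2 + enum_rank j
  end.

Definition slack_color (T I : finType) (c : T -> I) (u : T + I) : I :=
  match u with inl x => c x | inr j => j end.

Lemma slack_rank_inj (T I : finType) (r : I -> T -> nat) (i : I) :
  injective (r i) -> injective (slack_rank r i).
Proof.
move=> r_inj; have le x : r i x <= \max_x r i x by exact: leq_bigmax.
move=> [x|j] [y|k] /=.
- by move=> [/r_inj ->].
- by case: ifP => // _; have := le x; lia.
- by case: ifP => // _; have := le y; lia.
- case: ifP => [/eqP ->|_]; case: ifP => [/eqP ->|_] //.
  by move=> /addnI/val_inj/enum_rank_inj ->.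
Qed.

Lemma slack_rank_lt (T I : finType) (r : I -> T -> nat) (i j : I) (x : T) :
  j != i -> slack_rank r i (inl x) < slack_rank r i (inr j).
Proof.
move=> /negbTE ji; rewrite /= ji.
have := @leq_bigmax T (r i) x; lia.
Qed.

Lemma slack_face_primitive (T I : finType) (r : I -> T -> nat) (i0 : I) :
  primitive (slack_rank r) [set inr j | j in [set~ i0]].
Proof.
apply/primitiveP => -[y|j]; last by exists j => x _; rewrite /= eqxx.
exists i0 => x /imsetP[l]; rewrite !inE => li0 ->.
exact/ltnW/slack_rank_lt.
Qed.

(** A primitive door has two completions, except for the faces spanned by all slack
    elements but one: these lie on the boundary and have only one. The colors of
    D leave the face without i0 as the only such exception. *)
Lemma door_parity (T I : finType) (r : I -> T -> nat) (c : T -> I)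
    (i0 : I) (D : {set T + I}) :
  1 < #|I| -> (forall i, injective (r i)) -> #|D|.+1 = #|I| ->
  slack_color c @: D = [set~ i0] ->
  odd #|[set x | (x \notin D) && primitive (slack_rank r) (x |: D)]|
    = (D == [set inr j | j in [set~ i0]]).
Proof.
move=> I1 r_inj cardD cD; set F := imset _ _.
have rs_inj i : injective (slack_rank r i) by exact: slack_rank_inj.
have [D_prim|D_prim] := boolP (primitive (slack_rank r) D); last first.
  rewrite (_ : [set x | _] = set0) ?cards0; last first.
    apply/setP => x; rewrite !inE; apply: contraNF D_prim => /andP[_].
    exact/primitiveS/subsetUr.
  by apply/esym; apply: contraNF D_prim => /eqP ->; exact: slack_face_primitive.
have [x0 x0D] : exists x0, x0 \in D by apply/set0Pn; rewrite -card_gt0; lia.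
pose m i := [arg min_(x < x0 in D) slack_rank r i x].
have mD i : m i \in D by rewrite /m; case: arg_minnP.
have m_min i x : x \in D -> slack_rank r i (m i) <= slack_rank r i x.
  by move=> xD; rewrite /m; case: arg_minnP => // z _; apply.
have [i [j ij mij]] : exists i, exists2 j, i != j & m i = m j.
  apply/injectivePn; apply/negP => /injectiveP m_inj.
  have : #|m @: setT| <= #|D|.
    by apply/subset_leq_card/subsetP => _ /imsetP[i _ ->].
  by rewrite card_imset // cardsT -cardD ltnn.
(* A slack element of D is its own minimum, having rank 0. *)
have m_slack k : inr k \in D -> m k = inr k.
  move=> /(m_min k); rewrite {2}/slack_rank eqxx leqn0 => /eqP mk0.
  by apply: (rs_inj k); rewrite mk0 /= eqxx.
rewrite (completions rs_inj mD m_min ij mij D_prim cardD).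
(* The number of completions is the number of nonempty sides among i and j. On
   the slack face, only the side of i0 is nonempty; on any other door both are. *)
have [DF|DF] := eqVneq D F.
  have DE x : (x \in D) = if x is inr l then l != i0 else false.
    rewrite DF; apply/imsetP/idP => [[l]|]; first by rewrite !inE => li0 ->.
    by case: x => // l li0; exists l; rewrite ?inE.
  have face k : k != i0 -> m k = m i0 ->
      beyond (slack_rank r) m k = set0 /\ beyond (slack_rank r) m i0 != set0.
    move=> ki0 mk; have mE l : l != i0 -> m l = inr l.
      by move=> li0; apply: m_slack; rewrite DE.
    split; last first.
      apply/set0Pn; exists (inr i0); rewrite inE; apply/forall_inP => l li0.
      by rewrite mE //= eqxx eq_sym (negbTE li0).
    apply/setP => x; rewrite !inE; apply/negP => /forall_inP x_bey.
    have i0k : i0 != k by rewrite eq_sym.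
    have := x_bey _ i0k; rewrite -mk mE //.
    case: x x_bey => [x|l] x_bey.
      by rewrite ltnNge ltnW // slack_rank_lt.
    have [->|li0] := eqVneq l i0; first by rewrite /= eqxx.
    have [->|lk] := eqVneq l k; first by rewrite ltnn.
    by have := x_bey _ lk; rewrite mE // ltnn.
  have [ii0|ii0] := eqVneq i i0.
    rewrite ii0 in ij mij *; have [| |-> ->] := face j; rewrite ?eqxx //.
    by rewrite eq_sym.
  have [ji0|ji0] := eqVneq j i0.
    by rewrite ji0 in mij *; have [| |-> ->] := face i; rewrite ?eqxx.
  move: mij; rewrite !m_slack ?DE // => -[ij'].
  by rewrite ij' eqxx in ij.
have inner k k' : k != k' -> m k = m k' -> beyond (slack_rank r) m k != set0.
  move=> kk' mk; have [kD|kD] := boolP (inr k \in D).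
    case/eqP: DF; suff DE : D = [set inr j | j in [set~ k']].
      suff i0k' : i0 = k' by rewrite DE /F i0k'.
      have cDk' : slack_color c @: D = [set~ k'].
        by rewrite DE -imset_comp imset_id.
      by apply/eqP; rewrite -in_set1 -[_ \in _]negbK -in_setC -cDk' cD !inE eqxx.
    apply/eqP; rewrite eqEcard card_imset ?cardsC1; last by move=> ? ? [].
    rewrite -cardD leqnn andbT; apply/subsetP => x xD.
    have := m_min k' _ xD; rewrite -mk (m_slack k) //.
    case: x xD => [x|l] xD; first by rewrite leqNgt slack_rank_lt.
    move=> lk; apply/imsetP; exists l => //; rewrite !inE.
    by apply: contraTneq lk => ->; rewrite /= eqxx (negbTE kk').
  apply/set0Pn; exists (inr k); rewrite inE; apply/forall_inP => l lk.
  have kl : k != l by rewrite eq_sym.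
  have [lD|lD] := boolP (inr l \in D).
    by rewrite m_slack //= eqxx (negbTE kl).
  have [x xD] : exists x, inl x \in D.
    apply/existsP; apply: contraTT I1; rewrite negb_exists => /forallP noT.
    have : #|D| <= #|[set (inr j : T + I) | j in ~: [set k; l]]|.
      apply/subset_leq_card/subsetP => -[x|h] hD; first by have := noT x; rewrite hD.
      apply/imsetP; exists h => //; rewrite !inE.
      by apply/negP => /orP[] /eqP hE; move: hD; rewrite hE ?(negbTE kD) ?(negbTE lD).
    rewrite card_imset; last by move=> ? ? [].
    move: (cardsC [set k; l]); rewrite cards2 kl -cardD => /eqP.
    by rewrite !addSn add0n !eqSS => /eqP <-; rewrite ltnn.
  exact: leq_ltn_trans (m_min _ _ xD) (slack_rank_lt _ _ kl).
by rewrite (inner i j) // (inner j i) // eq_sym.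
Qed.

(** The doors without color i0 have an odd total number of completions, by
    [door_parity]; since a primitive set that is not rainbow absorbs an even
    number of them, some primitive set is rainbow. Its points form S: its slack
    elements carry precisely the colors that are missing from S, and they cannot
    witness primitivity, so the witnesses are colors of S. *)
Lemma scarf (T I : finType) (r : I -> T -> nat) (c : T -> I) :
  1 < #|I| -> 0 < #|T| ->
  exists S : {set T}, forall y, exists2 i, i \in c @: S &
    forall x, x \in S -> r i y <= r i x.
Proof.
move=> I1 T0.
(* Breaking ties by an enumeration makes the ranks injective and refines r. *)
pose r' i x := r i x * #|T| + enum_rank x.
have r'_inj i : injective (r' i).
  move=> x y /(congr1 (fun k => k %% #|T|)).
  by rewrite !modnMDl !modn_small // => /val_inj/enum_rank_inj.
have r'_mono i x y : r' i y <= r' i x -> r i y <= r i x.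
  rewrite /r' leqNgt [r i y <= _]leqNgt; apply: contra => xy.
  apply: leq_trans (leq_addr _ _); apply: leq_trans (leq_mul xy (leqnn _)).
  by rewrite mulSn addnC ltn_add2r.
have [i0 _] : exists i0 : I, true by move/card_gt0P: (ltnW I1) => [i0 _]; exists i0.
pose count (P : {set T + I}) := #|[set x in P | slack_color c @: (P :\ x) == [set~ i0]]|.
pose face : {set T + I} := [set inr j | j in [set~ i0]].
have card_face : #|face|.+1 = #|I|.
  by rewrite card_imset ?cardsC1 ?prednK ?(ltnW I1) // => ? ? [].
have c_face : slack_color c @: face = [set~ i0].
  by rewrite -imset_comp imset_id.
have : odd (\sum_(P : {set T + I}
    | (#|P| == #|I|) && primitive (slack_rank r') P) count P).
  rewrite -door_room_count (bigD1 face) /= ?card_face ?c_face ?eqxx //.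
  rewrite oddD (door_parity I1 r'_inj card_face c_face) eqxx.
  rewrite (big_morph odd oddD (erefl : odd 0 = false)) big1 // => D.
  move=> /andP[/andP[/eqP cardD /eqP cD] DF].
  by rewrite (door_parity I1 r'_inj cardD cD) (negbTE DF).
have [/exists_inP[P /andP[/eqP cardP P_prim] cP] _|no] := boolP [exists (P : {set T + I} |
    (#|P| == #|I|) && primitive (slack_rank r') P), slack_color c @: P == setT];
    last first.
  rewrite (big_morph odd oddD (erefl : odd 0 = false)) big1 // => P P_ok.
  move: no; rewrite negb_exists_in => /forall_inP/(_ P P_ok) cP.
  by apply/negbTE/even_rainbow_facets => //; case/andP: P_ok => /eqP.
(* The slack element of index i has rank 0 for i, so it cannot be above y. *)
exists [set x | inl x \in P] => y.
have /primitiveP/(_ (inl y))[i hi] := P_prim.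
exists i.
  have : i \in slack_color c @: P by rewrite (eqP cP) inE.
  case/imsetP => -[x|j] xP /= ij.
    by rewrite ij; apply/imsetP; exists x; rewrite ?inE.
  by have := hi _ xP; rewrite ij /= eqxx.
move=> x; rewrite inE => xP; apply: r'_mono.
exact: (hi (inl x)).
Qed.

Local Open Scope ring_scope.
Local Open Scope classical_set_scope.

(** * Brouwer's fixed point theorem on the simplex *)

(** The points of the simplex whose barycentric coordinates are multiples of
    1/N, with the coordinates scaled by N. *)
Local Notation grid n N :=
  {x : {ffun 'I_n -> 'I_N.+1} | (\sum_i (x i : nat) == N)%N}.

Lemma grid_point (n N : nat) (y : 'I_n -> nat) :
  (\sum_i y i = N)%N -> exists x : grid n N, forall i, val x i = y i :> nat.
Proof.
move=> yN; have y_lt i : (y i < N.+1)%N.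
  by rewrite ltnS -yN (bigD1 i) //= leq_addr.
pose x := [ffun i => Ordinal (y_lt i)].
have xN : (\sum_i (x i : nat) == N)%N.
  by apply/eqP; rewrite -[RHS]yN; apply: eq_bigr => i _; rewrite ffunE.
by exists (exist _ x xN) => i; rewrite /= ffunE.
Qed.

(** A set S as in [scarf] is small. Let m_i be its i-th minimum for i in the set C
    of its colors. If the numbers m_i + 1 had sum at most N, some grid point would
    exceed m_i in every coordinate of C, which is excluded. As coordinates add
    up to N, those of the points of S differ from m_i, or from 0 outside C, by at
    most the number of colors minus one. *)
Lemma grid_scarf (n N : nat) (c : grid n.+2 N -> 'I_n.+2) :
  exists x0 : grid n.+2 N, forall i, (val x0 i <= n.+1)%N \/
    exists2 x : grid n.+2 N, c x = i &
      forall j, (val x j <= val x0 j + n.+1)%N /\ (val x0 j <= val x j + n.+1)%N.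
Proof.
have T0 : (0 < #|{: grid n.+2 N}|)%N.
  have [|x _] := @grid_point n.+2 N (fun i => if i == ord0 then N else 0%N).
    by rewrite (bigD1 ord0) //= big1 ?addn0 // => i /negbTE ->.
  by apply/card_gt0P; exists x.
have I1 : (1 < #|'I_n.+2|)%N by rewrite card_ord.
have [S S_dom] := scarf (fun i (x : grid n.+2 N) => val x i) c I1 T0.
have [x0 x0S] : exists x0, x0 \in S.
  have /card_gt0P[y _] := T0; have [i] := S_dom y.
  by case/imsetP => x xS _ _; exists x.
pose C := c @: S.

pose m i : nat := val [arg min_(x < x0 in S) (val x i : nat)] i.
have m_min i x : x \in S -> (m i <= val x i)%N.
  by move=> xS; rewrite /m; case: arg_minnP => // z _; apply.
have m_dom (y : grid n.+2 N) : exists2 i, i \in C & (val y i <= m i)%N.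
  have [i iC hi] := S_dom y; exists i => //.
  by rewrite /m; case: arg_minnP => // z zS _; apply: hi.
have m_big : (N < \sum_(i in C) (m i).+1)%N.
  rewrite ltnNge; apply/negP => le_N.
  have i1C : c x0 \in C by apply: imset_f.
  pose y i := if i \in C
    then ((m i).+1 + (if i == c x0 then N - \sum_(i in C) (m i).+1 else 0))%N
    else 0%N.
  have [|x xE] := @grid_point n.+2 N y.
    rewrite /y -big_mkcond big_split /= [X in (_ + X)%N](bigD1 (c x0)) //= eqxx.
    rewrite [X in (_ + (_ + X))%N]big1 => [|i /andP[_ /negbTE ->] //].
    by rewrite addn0 subnKC.
  have [i iC] := m_dom x; rewrite xE /y iC leqNgt => /negP; apply.
  by rewrite addSn ltnS leq_addr.
have upper x i : x \in S -> (val x i <= (if i \in C then m i else 0) + n.+1)%N.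
  move=> xS; have le_C : (\sum_(j in C) (m j).+1 <= \sum_(j in C) m j + n.+2)%N.
    under eq_bigr do rewrite -addn1.
    by rewrite big_split sum1_card leq_add2l (leq_trans (max_card _)) ?card_ord.
  have xN : (val x i + \sum_(j | j != i) val x j)%N = N.
    by rewrite -[RHS](eqP (valP x)) [RHS](bigD1 i).
  have m_le : (\sum_(j in C) m j
      <= (if i \in C then m i else 0) + \sum_(j | j != i) val x j)%N.
    rewrite big_mkcond (bigD1 i) //= leq_add2l leq_sum // => j _.
    by case: ifP => // _; apply: m_min.
  have arith a b s s' t : (a + b = N -> s' <= s + n.+2 -> N < s' ->
    s <= t + b -> a <= t + n.+1)%N by lia.
  exact: arith xN le_C m_big m_le.
exists x0 => i; have [|iC] := boolP (i \in C); last first.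
  by left; have := upper _ i x0S; rewrite (negbTE iC).
case/imsetP => x xS ->; right; exists x => // j.
have lower x' : x' \in S -> ((if j \in C then m j else 0) <= val x' j)%N.
  by case: ifP => // _; apply: m_min.
split; apply: leq_trans (upper _ j _) _ => //; by rewrite leq_add2r lower.
Qed.

Definition simplex (R : realType) (n : nat) : set 'rV[R]_n :=
  [set z | (forall i, 0 <= z 0 i) /\ \sum_i z 0 i = 1].

Lemma ler_mx_norm (R : realType) n (z : 'rV[R]_n) (e : R) :
  0 <= e -> (forall i, `|z 0 i| <= e) -> `|z| <= e.
Proof.
move=> e0 h; rewrite [leLHS]/Num.norm /= mx_normrE; apply/bigmax_leP; split => //.
by move=> [i j] _ /=; rewrite ord1.
Qed.

Lemma ler_coord_norm (R : realType) n (z : 'rV[R]_n) i : `|z 0 i| <= `|z|.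
Proof.
rewrite [leRHS]/Num.norm /= mx_normrE.
exact: (le_bigmax _ (fun ij => `|z ij.1 ij.2|) (0, i)).
Qed.

(** A grid point w is colored by an index i with w_i <= f(w)_i, which exists
    because both points have coordinate sum 1. Near a set as in [grid_scarf]
    every color occurs, except those whose coordinate is almost zero, for which
    the inequality is automatic up to e. *)
Lemma approximate_fixed_point (R : realType) (n : nat)
    (f : 'rV[R]_n.+2 -> 'rV[R]_n.+2) (e : R) :
  (forall z, simplex z -> simplex (f z)) -> 0 < e ->
  exists2 z, simplex z & forall i, exists2 w, simplex w &
    `|w - z| <= e /\ w 0 i <= f w 0 i + e.
Proof.
move=> f_simplex e0.
pose N := Num.bound (n.+1%:R / e).
have N_e : n.+1%:R / e < N%:R by apply: archi_boundP; rewrite divr_ge0 ?ltW.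
have N0 : 0 < N%:R :> R by apply: le_lt_trans N_e; rewrite divr_ge0 ?ltW.
have close (a b : nat) : (a <= b + n.+1)%N -> a%:R / N%:R - b%:R / N%:R <= e.
  move=> ab; rewrite -mulrBl ler_pdivrMr // mulrC.
  move: N_e; rewrite ltr_pdivrMr // => /ltW; apply: le_trans.
  by rewrite lerBlDl -natrD ler_nat.
pose pt (x : grid n.+2 N) : 'rV[R]_n.+2 := \row_i ((val x i)%:R / N%:R).
have pt_simplex x : simplex (pt x).
  split=> [i|]; first by rewrite mxE divr_ge0 // ltW.
  under eq_bigr do rewrite mxE.
  by rewrite -mulr_suml -natr_sum (eqP (valP x)) divff // gt_eqF.
pose c x := odflt ord0 [pick i | pt x 0 i <= f (pt x) 0 i].
have cP x : pt x 0 (c x) <= f (pt x) 0 (c x).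
  rewrite /c; case: pickP => //= no.
  have [_ s1] := pt_simplex x; have [_ s2] := f_simplex _ (pt_simplex x).
  suff : \sum_i f (pt x) 0 i < \sum_i pt x 0 i by rewrite s1 s2 ltxx.
  apply: ltr_sum; first by apply/hasP; exists ord0; rewrite ?mem_index_enum.
  by move=> i _; rewrite ltNge no.
have [x0 hx0] := grid_scarf c.
exists (pt x0) => // i; case: (hx0 i) => [small|[x <- hx]].
  exists (pt x0); rewrite // subrr normr0 (ltW e0); split=> //.
  have [f0 _] := f_simplex _ (pt_simplex x0).
  rewrite (le_trans _ (lerD (f0 i) (lexx e))) // add0r mxE.
  by have := close (val x0 i) 0%N; rewrite mul0r subr0; apply.
exists (pt x) => //; split; last first.
  by apply: (le_trans (cP x)); rewrite lerDl ltW.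
apply: ler_mx_norm (ltW e0) _ => j; rewrite !mxE.
have [h1 h2] := hx j; rewrite ler_norml close // andbT.
by rewrite lerNl opprB close.
Qed.

Lemma simplex_compact (R : realType) (n : nat) : compact (@simplex R n).
Proof.
apply: bounded_closed_compact.
  exists 1; split; first by rewrite realE ler01.
  move=> M M1 z [z0 z1]; apply: ler_mx_norm => [|i].
    by rewrite (le_trans ler01) ?ltW.
  rewrite ger0_norm // (le_trans _ (ltW M1)) // -z1 (bigD1 i) //= lerDl.
  exact: sumr_ge0.
have -> : @simplex R n = (\bigcap_i [set z | 0 <= z 0 i]) `&`
    [set z | \sum_i z 0 i = 1].
  by apply/seteqP; split=> z [z0 z1]; split=> // i; [move=> _|]; apply: z0.
have coord i : continuous (fun z : 'rV[R]_n => z 0 i) by exact: coord_continuous.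
apply: closedI.
  apply: closed_bigI => i _; move: (coord i) => /continuous_closedP.
  by move=> /(_ _ (@closed_ge R 0)).
have : continuous (fun z : 'rV[R]_n => \sum_i z 0 i).
  by apply: continuous_big => //; exact: add_continuous.
by move=> /continuous_closedP/(_ _ (@closed_eq R 1)).
Qed.

(** It suffices that z_i <= f(z)_i for all i, as both sides have sum 1. If every z
    violated this for some i, continuity would make z and all nearby points fail
    the conclusion of [approximate_fixed_point] for all small e, and by
    compactness a single e would serve the whole simplex. *)
Theorem brouwer (R : realType) (n : nat) (f : 'rV[R]_n.+1 -> 'rV[R]_n.+1) :
  (forall z, simplex z -> simplex (f z)) ->
  {within @simplex R n.+1, continuous f} ->
  exists2 z, simplex z & f z = z.
Proof.
move=> f_simplex f_cont.
suff [z z_simplex zf] : exists2 z, simplex z & forall i, z 0 i <= f z 0 i.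
  exists z => //; apply/esym/rowP => i; apply/eqP.
  have [_ z1] := z_simplex; have [_ fz1] := f_simplex _ z_simplex.
  have : \sum_i (f z 0 i - z 0 i) == 0 by rewrite sumrB z1 fz1 subrr.
  rewrite psumr_eq0 => [/allP/(_ i)|j _]; last by rewrite subr_ge0.
  by rewrite mem_index_enum subr_eq0 eq_sym => /(_ isT).
case: n f f_simplex f_cont => [|n] f f_simplex f_cont.
  exists (const_mx 1); first by split=> [i|]; rewrite ?big_ord1 ?mxE ?ler01.
  move=> i; have [] := f_simplex (const_mx 1); last first.
    by move=> _; rewrite big_ord1 (ord1 i) => ->; rewrite mxE.
  by split=> [j|]; rewrite ?big_ord1 ?mxE ?ler01.
apply: contrapT => no_z.
have := @simplex_compact R n.+2 => /compact_near_coveringP.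
pose good (e : R) z := forall i, exists2 w : 'rV[R]_n.+2, simplex w &
    `|w - z| <= e /\ w 0 i <= f w 0 i + e.
move=> /(_ R 0^'+ (fun e z => ~ good e z)).
have [z_cover|] := pselect (forall z, simplex z ->
    \forall z' \near z & e \near 0^'+, ~ good e z'); last first.
  move=> bad _; apply: bad => z z_simplex.
  have [i zi] : exists i, f z 0 i < z 0 i.
    apply: contrapT => no_i; apply: no_z; exists z => // i.
    by rewrite leNgt; apply/negP => ?; apply: no_i; exists i.
  pose d := (z 0 i - f z 0 i) / 3.
  have d0 : 0 < d by rewrite divr_gt0 // subr_gt0.
  have /subspace_continuousP/(_ z z_simplex)/cvgrPdist_lt/(_ d d0) := f_cont.
  rewrite near_withinE => /nbhs_normP[rho /= rho0 f_near].
  (* Points w within e0 of some z' within e0 of z still see the gap of 3 d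
     between z_i and f(z)_i, reduced to at least d; this beats the slack e. *)
  pose e0 := Num.min (rho / 2) (d / 2).
  have e00 : 0 < e0 by rewrite lt_min (divr_gt0 rho0) // (divr_gt0 d0).
  exists (ball z e0, [set e | e < e0]) => /=.
    by split; [exact: nbhsx_ballx | exact: nbhs_right_lt].
  move=> [z' e] /= [zz' ee0] /(_ i)[w w_simplex [wz' wf]].
  have {}zz' : `|z - z'| < e0 by move: zz'; rewrite -ball_normE.
  have wz : `|z - w| < e0 + e0.
    rewrite -(subrKA z' z) (le_lt_trans (ler_normD _ _)) // ltrD //.
    by rewrite distrC (le_lt_trans wz').
  have e0_rho : e0 + e0 <= rho.
    by have : e0 <= rho / 2 by [rewrite ge_min lexx]; lra.
  have e0_d : e0 <= d / 2 by rewrite ge_min lexx orbT.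
  have := f_near w (lt_le_trans wz e0_rho) w_simplex.
  move=> /(le_lt_trans (ler_coord_norm _ i)).
  move: (le_lt_trans (ler_coord_norm (z - w) i) wz).
  rewrite !mxE !ltr_norml => /andP[_ h1] /andP[h2 _].
  have : z 0 i - f z 0 i = 3 * d by rewrite /d mulrC divfK.
  lra.
move=> /(_ _ z_cover) near_bad.
suff : \forall e \near (0 : R)^'+, False by move=> /filter_ex[].
near=> e; have e0 : 0 < e by [].
have [z z_simplex zP] := approximate_fixed_point f_simplex e0.
have : @simplex R n.+2 `<=` (fun z => ~ good e z) by near: e.
by move=> /(_ z z_simplex); apply.
Unshelve. all: by end_near.
Qed.

(** * Zeros of continuous maps *)

Lemma cvg_row (R : realType) (T : Type) (n : nat) (F : set_system T)
    (f : 'I_n -> T -> R) (l : 'I_n -> R) : Filter F ->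
  (forall i, f i x @[x --> F] --> l i) ->
  (\row_i f i x) @[x --> F] --> (\row_i l i : 'rV[R]_n).
Proof.
move=> FF f_l; apply/cvgrPdist_le => e e0.
have : \forall x \near F, forall i, `|l i - f i x| <= e.
  by apply: filter_forall => i; have /cvgrPdist_le/(_ e e0) := f_l i.
by apply: filterS => x fx; apply: ler_mx_norm (ltW e0) _ => i; rewrite !mxE.
Qed.

Lemma cvg_sum (R : realType) (T : Type) (I : Type) (r : seq I) (P : pred I)
    (F : set_system T) (f : I -> T -> R) (l : I -> R) : Filter F ->
  (forall i, P i -> f i x @[x --> F] --> l i) ->
  \sum_(i <- r | P i) f i x @[x --> F] --> \sum_(i <- r | P i) l i.
Proof. by move=> FF; apply: cvg_big; exact: add_continuous. Qed.

Lemma cvg_prod (R : realType) (T : Type) (I : Type) (r : seq I) (P : pred I)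
    (F : set_system T) (f : I -> T -> R) (l : I -> R) : Filter F ->
  (forall i, P i -> f i x @[x --> F] --> l i) ->
  \prod_(i <- r | P i) f i x @[x --> F] --> \prod_(i <- r | P i) l i.
Proof. by move=> FF; apply: cvg_big; exact: mul_continuous. Qed.

(** If G has no zero, y |-> - r G(y) / |G(y)| maps everything to the sphere of
    radius r, and a fixed point y would satisfy G(y) = - s y with s > 0 and
    |y| = r > M. To produce the fixed point, R^n is identified with the hyperplane
    of coordinate sum 1 in R^(n+1), scaled so that the ball of radius r goes into
    the standard simplex. *)
Lemma leray_schauder (R : realType) (n : nat) (G : 'rV[R]_n -> 'rV[R]_n)
    (M : R) :
  continuous G ->
  (forall y s, 0 < s -> G y = - (s *: y) -> `|y| <= M) ->
  exists y, G y = 0.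
Proof.
case: n G => [|n] G G_cont G_bound; first by exists 0; apply/rowP => -[].
apply: contrapT => no_zero.
have G0 y : 0 < `|G y|.
  by rewrite normr_gt0; apply/eqP => Gy; apply: no_zero; exists y.
pose r := `|M| + 1; have r0 : 0 < r by rewrite ltr_wpDl.
have Mr : M < r by rewrite (le_lt_trans (ler_norm M)) // ltrDl.
(* With d = n + 1, phi sends the barycenter of the simplex to 0 and the simplex
   onto one that contains the sup-norm ball of radius r; hat completes a vector
   by a coordinate that makes the sum 0. *)
pose d : R := n.+1%:R; have d0 : 0 < d by rewrite ltr0n.
have d10 : 0 < d + 1 by rewrite ltr_wpDl // ltW.
pose phi (z : 'rV[R]_n.+2) : 'rV[R]_n.+1 :=
  \row_i (d * r * ((d + 1) * z 0 (lift ord0 i) - 1)).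
pose u (y : 'rV[R]_n.+1) := - (`|G y|^-1 *: G y).
have u1 y : `|u y| = 1.
  by rewrite normrN normrZ normfV normr_id mulVf ?gt_eqF.
pose hat (w : 'rV[R]_n.+1) (k : 'I_n.+2) :=
  if unlift ord0 k is Some i then w 0 i else - \sum_i w 0 i.
have hat_bound y k : `|hat (u y) k| <= d.
  have u_le i : `|u y 0 i| <= 1 by rewrite -(u1 y) ler_coord_norm.
  rewrite /hat; case: unlift => [i|].
    by rewrite (le_trans (u_le i)) // ler1n.
  rewrite normrN (le_trans (ler_norm_sum _ _ _)) //.
  by rewrite (le_trans (ler_sum _ (fun i _ => u_le i))) // sumr_const card_ord.
have hat_sum w : \sum_k hat w k = 0.
  rewrite big_ord_recl /hat unlift_none.
  by under [X in _ + X]eq_bigr do rewrite liftK; rewrite addNr.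
pose f (z : 'rV[R]_n.+2) : 'rV[R]_n.+2 :=
  \row_k ((1 + hat (u (phi z)) k / d) / (d + 1)).
have f_simplex z : simplex z -> simplex (f z).
  move=> _; split=> [k|].
    rewrite mxE divr_ge0 ?(ltW d10) // addrC -lerBlDr sub0r.
    by rewrite ler_pdivlMr // mulN1r lerNl (le_trans (ler_norm _)) // normrN.
  under eq_bigr do rewrite mxE.
  rewrite -mulr_suml big_split /= -mulr_suml hat_sum mul0r addr0.
  by rewrite sumr_const card_ord -natr1 divff // gt_eqF.
have coord m (i : 'I_m) (x : 'rV[R]_m) : z 0 i @[z --> x] --> x 0 i.
  exact: coord_continuous.
have phi_cont : continuous phi.
  move=> z; apply: (cvg_row (F := nbhs z)) => i.
  apply: cvgM; first exact: cvg_cst.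
  by apply: cvgB; [apply: cvgM; [exact: cvg_cst | exact: coord] | exact: cvg_cst].
have u_cont : continuous u.
  have inv_cont : continuous (fun y => `|G y|^-1).
    move=> y; apply: (@cvgV R _ (nbhs y) _ (fun x => `|G x|)).
      by rewrite gt_eqF.
    exact: (cvg_norm (G_cont y)).
  move=> y; exact: (cvgN (cvgZ (inv_cont y) (G_cont y))).
have f_cont : continuous f.
  move=> z; apply: (cvg_row (F := nbhs z)) => k.
  apply: cvgM; last exact: cvg_cst.
  apply: cvgD; first exact: cvg_cst.
  apply: cvgM; last exact: cvg_cst.
  have uphi_cont i : u (phi x) 0 i @[x --> z] --> u (phi z) 0 i.
    apply: (cvg_comp _ _ _ (coord _ i _)).
    exact: (cvg_comp _ _ (phi_cont z) (u_cont (phi z))).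
  rewrite /hat; case: unlift => [i|]; first exact: uphi_cont.
  by apply: cvgN; apply: cvg_sum => i _; exact: uphi_cont.
have [z _ fz] := brouwer f_simplex (continuous_subspaceT f_cont).
have phi_u : phi z = r *: u (phi z).
  apply/rowP => i; rewrite [LHS]mxE -[in LHS]fz !mxE /hat liftK.
  rewrite !mxE [d * r]mulrC -!mulrA; congr (r * _).
  rewrite [X in X - 1]mulrC divfK ?gt_eqF // addrAC subrr add0r.
  by rewrite mulrC divfK ?gt_eqF.
have : `|phi z| <= M.
  apply: (G_bound _ (`|G (phi z)| / r)); first exact: divr_gt0.
  rewrite [X in _ *: X]phi_u scalerA divfK ?gt_eqF // /u scalerN opprK scalerA.
  by rewrite divff ?gt_eqF // scale1r.
by rewrite phi_u normrZ u1 mulr1 gtr0_norm // leNgt Mr.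
Qed.

(** The root is sgn(y) |y|^(1/q); it is continuous as the inverse of a continuous
    real function. *)
Lemma odd_root (R : realType) (q : nat) : odd q ->
  exists2 g : R -> R, continuous g & forall y, g y ^+ q = y.
Proof.
move=> q_odd; have q0 : (0 < q)%N by case: q q_odd.
have qR : q%:R != 0 :> R by rewrite pnatr_eq0 -lt0n.
have sg_odd (x : R) : Num.sg x ^+ q = Num.sg x.
  rewrite -(odd_double_half q) q_odd exprS -mul2n exprM sqr_sg.
  have [->|x0] := eqVneq x 0; first by rewrite sgr0 mul0r.
  by rewrite expr1n mulr1.
pose g (y : R) := Num.sg y * `|y| `^ q%:R^-1.
have gK y : g y ^+ q = y.
  rewrite exprMn sg_odd -powR_mulrn ?powR_ge0 // -powRrM mulVf //.
  by rewrite powRr1 // -numEsg.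
have Kg x : g (x ^+ q) = x.
  rewrite /g sgrX sg_odd normrX -powR_mulrn // -powRrM mulfV //.
  by rewrite powRr1 // -numEsg.
exists g => // y; suff: {for g y ^+ q, continuous g} by rewrite gK.
have : {near g y ^+ q, continuous g}.
  apply: (@near_can_continuous R (fun x => x ^+ q)); near=> x => //.
  exact: exprn_continuous.
by move=> /nbhs_singleton.
Unshelve. all: by end_near. Qed.

(** By homogeneity it is enough to treat |x| = 1. There t |H x| - |F x| >= 1 as soon
    as t >= K, and for t in [0, K] the minimum is attained on a compact set. *)
Lemma homogeneous_coercive (R : realType) (n q : nat)
    (F H : 'rV[R]_n -> 'rV[R]_n) : (0 < q)%N ->
  continuous F -> continuous H ->
  (forall a x, 0 <= a -> F (a *: x) = a ^+ q *: F x) ->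
  (forall a x, 0 <= a -> H (a *: x) = a ^+ q *: H x) ->
  (forall x, x != 0 -> H x != 0) ->
  (forall x t, x != 0 -> 0 <= t -> F x + t *: H x != 0) ->
  exists2 d, 0 < d &
    forall x t, 0 <= t -> d * `|x| ^+ q <= `|F x + t *: H x|.
Proof.
move=> q0 F_cont H_cont F_hom H_hom H0 FH0.
pose S : set 'rV[R]_n := [set x | `|x| = 1].
have S_neq0 x : S x -> x != 0.
  by move=> Sx; rewrite -normr_eq0 Sx oner_eq0.
have S_compact : compact S.
  apply: bounded_closed_compact.
    exists 1; split; first by rewrite realE ler01.
    by move=> M M1 x /= ->; rewrite ltW.
  have /continuous_closedP/(_ _ (@closed_eq R 1)) : continuous (fun x : 'rV[R]_n => `|x|).
    exact: norm_continuous.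
  by [].
suff [d d0 hd] : exists2 d, 0 < d &
    forall x t, S x -> 0 <= t -> d <= `|F x + t *: H x|.
  exists d => // x t t0; have [->|x0] := eqVneq x 0.
    by rewrite normr0 expr0n gtn_eqF // mulr0.
  have nx0 : `|x| != 0 by rewrite normr_eq0.
  have -> : x = `|x| *: (`|x|^-1 *: x) by rewrite scalerA mulfV // scale1r.
  rewrite F_hom // H_hom // scalerA mulrC [t * _]mulrC -scalerA -scalerDr.
  rewrite !normrZ normrX normr_id normfV normr_id mulVf // mulr1.
  rewrite ler_wpM2l ?exprn_ge0 //; apply: hd => //.
  by rewrite /S /= normrZ normfV normr_id mulVf.
have [S0|S_empty] := pselect (S !=set0); last first.
  by exists 1 => // x t Sx; case: S_empty; exists x.
have min_on (T : topologicalType) (A : set T) (f : T -> R) :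
    A !=set0 -> compact A -> continuous f -> (forall x, A x -> 0 < f x) ->
    exists2 m, 0 < m & forall x, A x -> m <= f x.
  move=> A0 A_compact f_cont f0.
  have [c cA hc] := compact_EVT_min A0 A_compact (continuous_subspaceT f_cont).
  exists (f c); first exact/f0/set_mem.
  by move=> x Ax; exact/hc/mem_set.
have [h h0 hh] : exists2 m, 0 < m & forall x, S x -> m <= `|H x|.
  apply: min_on => //; last by move=> x /S_neq0/H0; rewrite normr_gt0.
  by move=> x; exact: (cvg_norm (H_cont x)).
have [b bS hb] : exists2 b, b \in S & forall x, x \in S -> `|F x| <= `|F b|.
  apply: compact_EVT_max => //; apply: continuous_subspaceT => x.
  by exact: (cvg_norm (F_cont x)).
pose K := (`|F b| + 1) / h.
have K0 : 0 <= K by rewrite divr_ge0 ?addr_ge0 // ltW.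
have [m m0 hm] : exists2 m, 0 < m &
    forall w : 'rV[R]_n * R, (S `*` `[0, K]) w -> m <= `|F w.1 + w.2 *: H w.1|.
  apply: min_on.
  - by have [x Sx] := S0; exists (x, 0); split => //=; rewrite in_itv /= lexx.
  - by apply: compact_setX => //; exact: segment_compact.
  - move=> w; have w1 : v.1 @[v --> w] --> w.1 by exact: cvg_fst.
    have w2 : v.2 @[v --> w] --> w.2 by exact: cvg_snd.
    have Fw : F v.1 @[v --> w] --> F w.1 by exact: (cvg_comp _ _ w1 (F_cont w.1)).
    have Hw : H v.1 @[v --> w] --> H w.1 by exact: (cvg_comp _ _ w1 (H_cont w.1)).
    exact: (cvg_norm (cvgD Fw (cvgZ w2 Hw))).
  - move=> [x t] [/S_neq0 x0] /=; rewrite in_itv /= => /andP[t0 _].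
    by rewrite normr_gt0 FH0.
exists (Num.min 1 m); first by rewrite lt_min ltr01.
move=> x t Sx t0; have [tK|Kt] := leP t K.
  rewrite ge_min; apply/orP; right; apply: (hm (x, t)).
  by split => //=; rewrite in_itv /= t0.
rewrite ge_min; apply/orP; left.
rewrite addrC -[F x]opprK (le_trans _ (lerB_dist _ _)) // normrN normrZ ger0_norm //.
have Fx : `|F x| <= `|F b| by exact/hb/mem_set.
have : K * h <= t * `|H x| by apply: ler_pM => //; [exact: ltW | exact: ltW | exact: hh].
by rewrite /K divfK ?gt_eqF //; lra.
Qed.

(** * Tensor equations *)

Lemma tensor_apply_continuous (R : realType) (p n : nat) (A : tensor R p n) :
  continuous (tensor_apply A).
Proof.
move=> x; apply: (cvg_row (F := nbhs x)) => i.
apply: cvg_sum => s _; apply: cvgM; first exact: cvg_cst.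
apply: cvg_prod => j _; exact: coord_continuous.
Qed.

Lemma tensor_applyZ (R : realType) (p n : nat) (A : tensor R p n) a x :
  tensor_apply A (a *: x) = a ^+ p.-1 *: tensor_apply A x.
Proof.
apply/rowP => i; rewrite !mxE mulr_sumr; apply: eq_bigr => s _.
under eq_bigr do rewrite mxE.
rewrite big_split /= big_const_seq count_predT size_behead size_tuple.
by rewrite iter_mulr_1 mulrCA.
Qed.

Lemma tensor_applyD (R : realType) (p n : nat) (A B : tensor R p n) t x :
  tensor_apply (A + t *: B) x = tensor_apply A x + t *: tensor_apply B x.
Proof.
apply/rowP => i; rewrite !mxE mulr_sumr -big_split; apply: eq_bigr => s _.
by rewrite !ffunE mulrDl mulrA.
Qed.

(** The only constant multi-index that starts with i is (i, ..., i). *)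
Lemma unit_tensor_apply (R : realType) (p n : nat) (x : 'rV[R]_n) i :
  (0 < p)%N -> tensor_apply (unit_tensor R p n) x 0 i = x 0 i ^+ p.-1.
Proof.
case: p => // p _; rewrite mxE (bigD1 [tuple of nseq p.+1 i]) //=.
rewrite ffunE (constant_nseq p.+1 i : constant [tuple of nseq p.+1 i]).
rewrite mul1r big_nseq iter_mulr_1.
rewrite big1 ?addr0 // => s /andP[hs s_neq]; rewrite ffunE.
case: (boolP (constant s)) => [s_const|_]; last by rewrite mul0r.
case/eqP: s_neq; apply: val_inj => /=.
case: s hs s_const => -[|j s] //= /eqP sz /eqP[->] /all_pred1P ->.
by case: sz => ->.
Qed.

Lemma abs_vec_continuous (R : realType) (n : nat) : continuous (@abs_vec R n).
Proof.
have -> : @abs_vec R n = fun x => \row_i `|x 0 i|.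
  by apply/funext => x; apply/rowP => i; rewrite !mxE.
move=> x; apply: (cvg_row (F := nbhs x)) => i.
by apply: cvg_norm; exact: coord_continuous.
Qed.

Lemma abs_vecZ (R : realType) (n : nat) (a : R) (x : 'rV[R]_n) :
  0 <= a -> abs_vec (a *: x) = a *: abs_vec x.
Proof. by move=> a0; apply/rowP => i; rewrite !mxE normrM ger0_norm. Qed.

Theorem theorem3p5 (R : realType) (p n : nat) (A B : tensor R p n)
  (hp3 : (3 <= p)%N) (hpeven : ~~ odd p)
  (hAB : ~ exists (x : 'rV[R]_n) (t : R),
      [/\ x <> 0, 0 <= t &
        tensor_apply (A + t *: unit_tensor R p n) x
          + tensor_apply B (abs_vec x) = 0]) :
  forall b : 'rV[R]_n, SOL A B b !=set0 /\ compact (SOL A B b).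
Proof.
move=> b.
have q_odd : odd p.-1 by case: p hp3 hpeven {A B hAB} => //= p _; rewrite negbK.
have p0 : (0 < p)%N by exact: leq_trans hp3.
have q0 : (0 < p.-1)%N by case: p.-1 q_odd.
pose F x := tensor_apply A x + tensor_apply B (abs_vec x).
pose H := tensor_apply (unit_tensor R p n).
have F_cont : continuous F.
  move=> x; have Ax := @tensor_apply_continuous R p n A x.
  have Bx := cvg_comp _ _ (@abs_vec_continuous R n x)
    (@tensor_apply_continuous R p n B (abs_vec x)).
  exact: (cvgD Ax Bx).
have H_cont : continuous H by exact: tensor_apply_continuous.
have [d d0 hd] : exists2 d, 0 < d &
    forall x t, 0 <= t -> d * `|x| ^+ p.-1 <= `|F x + t *: H x|.
  apply: homogeneous_coercive => //.
  - by move=> a x a0; rewrite /F abs_vecZ // !tensor_applyZ scalerDr.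
  - by move=> a x _; rewrite /H tensor_applyZ.
  - move=> x; apply: contra_neq => Hx; apply/rowP => i; apply/eqP.
    move/rowP/(_ i): Hx; rewrite unit_tensor_apply // !mxE => /eqP.
    by rewrite expf_eq0 q0.
  - move=> x t x0 t0; apply/eqP => Fx; apply: hAB; exists x, t.
    by split=> //; [exact/eqP | rewrite tensor_applyD addrAC].
have bound x t : 0 <= t -> F x + t *: H x = b -> `|x| ^+ p.-1 <= `|b| / d.
  by move=> t0 <-; rewrite ler_pdivlMr // mulrC hd.
split; last first.
  apply: bounded_closed_compact; last first.
    have /continuous_closedP/(_ [set b]) := F_cont; apply.
    exact/accessible_closed_set1/hausdorff_accessible/norm_hausdorff.
  exists (Num.max 1 (`|b| / d)); split; first by rewrite num_real.
  move=> M; rewrite gt_max => /andP[M1 Mb] x Fx.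
  have [x1|x1] := leP `|x| 1; first exact: le_trans x1 (ltW M1).
  have x_bound : `|x| ^+ p.-1 <= `|b| / d.
    by apply: (bound x 0) => //; rewrite scale0r addr0.
  apply: le_trans (ltW Mb); apply: le_trans x_bound.
  by rewrite ler_eXnr // ltW.
have [g g_cont gK] := odd_root R q_odd.
pose root (y : 'rV[R]_n) : 'rV[R]_n := \row_i g (y 0 i).
have rootK y : H (root y) = y.
  by apply/rowP => i; rewrite unit_tensor_apply // mxE gK.
have root_cont : continuous root.
  move=> y; apply: (cvg_row (F := nbhs y)) => i.
  apply: (cvg_comp _ _ (@coord_continuous R _ _ 0 i y)); exact: g_cont.
have [|y s s0 Gy|y /eqP] := @leray_schauder R n (fun y => F (root y) - b) (`|b| / d).
- move=> y; have Fr : F (root z) @[z --> y] --> F (root y).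
    exact: (cvg_comp _ _ (root_cont y) (F_cont (root y))).
  apply: (cvgB Fr); exact: cvg_cst.
- have Fb : F (root y) + s *: H (root y) = b.
    by rewrite rootK -[F _](subrK b) Gy addrAC addNr add0r.
  apply: le_trans (bound _ _ (ltW s0) Fb).
  apply: ler_mx_norm => [|i]; first by rewrite exprn_ge0.
  rewrite -{1}[y]rootK unit_tensor_apply // normrX lerXn2r ?nnegrE //.
  exact: ler_coord_norm.
- by rewrite subr_eq0 => /eqP Fy; exists (root y).
Qed.
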